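(* Let $\sigma:\mathbb{R}\to\mathbb{R}$ be a smooth ReLU-like function, let $\mathbf{W}_{up}\in\mathbb{R}^{D\times d}$, $\mathbf{W}_{down}\in\mathbb{R}^{d\times D}$, let $\mathsf{F}(\mathbf{x})=\mathbf{W}_{down}\,\sigma^*(\mathbf{W}_{up}\mathbf{x})$ (with $\sigma^*$ the entrywise application of $\sigma$), and let $\mathbf{x}\in\mathbb{R}^d$. For every $\epsilon>0$ (with $\tau_\epsilon$ from the definition of a ReLU-like function) and every triplet $1\le p,q,r\le\infty$, the normwise condition numbers of $\mathsf{F}$ are bounded by $$\kappa_{p,q}(\mathsf{F},\mathbf{x})\le\Big(\epsilon\nu_-+\|\sigma'\|_{C([-\tau_\epsilon,\tau_\epsilon])}\nu_0+(1+\epsilon)\nu_+\Big)\frac{\|\mathbf{x}\|_p}{\|\mathsf{F}(\mathbf{x})\|_q},$$ where, for $\theta\in\{-,0,+\}$, $\nu_\theta=\|\mathbf{W}_{down}^{(\theta)}\|_{r,q}\|\mathbf{W}_{up}^{(\theta)}\|_{p,r}$, and, with $\mathbf{y}=\mathbf{W}_{up}\mathbf{x}$, $$\mathbf{W}_{down}^{(\theta)}=\mathbf{W}_{down}(:,\Omega_\theta),\quad\mathbf{W}_{up}^{(\theta)}=\mathbf{W}_{up}(\Omega_\theta,:),$$ $$\Omega_-=\{i:y_i<-\tau_\epsilon\},\quad\Omega_0=\{i:|y_i|\le\tau_\epsilon\},\quad\Omega_+=\{i:y_i>\tau_\epsilon\}.$$ Its mixed condition numbers are bounded by $$\kappa_{c,q}(\mathsf{F},\mathbf{x})\le\Big(\epsilon\xi_-+\|\sigma'\|_{C([-\tau_\epsilon,\tau_\epsilon])}\xi_0+(1+\epsilon)\xi_+\Big)\frac{1}{\|\mathsf{F}(\mathbf{x})\|_q},$$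 $$\kappa_{p,c}(\mathsf{F},\mathbf{x})\le\Big(\epsilon\eta_-+\|\sigma'\|_{C([-\tau_\epsilon,\tau_\epsilon])}\eta_0+(1+\epsilon)\eta_+\Big)\|\mathbf{x}\|_p,$$ where $$\xi_\theta=\|\mathbf{W}_{down}^{(\theta)}\|_{r,q}\|\mathbf{W}_{up}^{(\theta)}\mathrm{diag}(\mathbf{x})\|_{\infty,r},\qquad\eta_\theta=\|\mathrm{diag}(\mathsf{F}(\mathbf{x}))^{-1}\mathbf{W}_{down}^{(\theta)}\|_{r,\infty}\|\mathbf{W}_{up}^{(\theta)}\|_{p,r}.$$ The componentwise condition number is bounded by $$\kappa_{c,c}(\mathsf{F},\mathbf{x})\le\epsilon\chi_-+\|\sigma'\|_{C([-\tau_\epsilon,\tau_\epsilon])}\chi_0+(1+\epsilon)\chi_+,$$ where $\chi_\theta=\|\mathrm{diag}(\mathsf{F}(\mathbf{x}))^{-1}\mathbf{W}_{down}^{(\theta)}\|_{r,\infty}\|\mathbf{W}_{up}^{(\theta)}\mathrm{diag}(\mathbf{x})\|_{\infty,r}$.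
   Context: A smooth function $\sigma:\mathbb{R}\to\mathbb{R}$ is ReLU-like if for every $\epsilon>0$ there is $\tau_\epsilon>0$ such that $\max\{|\sigma(x)|,|\sigma'(x)|\}<\epsilon$ for $x<-\tau_\epsilon$ and $\max\{|\sigma(x)/x-1|,|\sigma'(x)-1|\}<\epsilon$ for $x>\tau_\epsilon$. $\|h\|_{C(I)}=\sup_{x\in I}|h(x)|$. $\|\cdot\|_{p,q}$ is the $\ell_p\to\ell_q$ operator norm of a matrix; $\mathbf W(:,\Omega)$ and $\mathbf W(\Omega,:)$ are the submatrices of columns, resp. rows, indexed by $\Omega$ (a term with empty $\Omega_\theta$ is zero). Condition numbers: for vectors $\hat{\mathbf w},\mathbf w$ put $\rho_p(\hat{\mathbf w},\mathbf w)=\|\hat{\mathbf w}-\mathbf w\|_p/\|\mathbf w\|_p$ and $\rho_c(\hat{\mathbf w},\mathbf w)=\max_i|(\hat w_i-w_i)/w_i|$, with the conventions $a/0=\infty$ for $a\ne0$ and $0/0=0$. For a function $f$, a point $\mathbf v$, and $\theta_{in},\theta_{out}\in[1,\infty]\cup\{c\}$, $$\kappa_{\theta_{in},\theta_{out}}(f,\mathbf v)=\lim_{t\to0}\sup\Big\{\frac{\rho_{\theta_{out}}(f(\hat{\mathbf v}),f(\mathbf v))}{\rho_{\theta_{in}}(\hat{\mathbf v},\mathbf v)}:\rho_{\theta_{in}}(\hat{\mathbf v},\mathbf v)\le t\Big\}$$ ($\hat{\mathbf v}=\mathbf v$ is allowed; the value may be infinite).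
   Formalization: Each bound is stated except when σ' vanishes on [-τ_ε,τ_ε] and ‖x‖_p/‖F(x)‖_q, 1/‖F(x)‖_q, η_0 or χ_0 respectively is infinite; there the right side involves 0·∞ and, read as 0, the bound can fail (possible only if ε ≥ 1 and some F_i(x) = 0). *)

(* Defs.v *)
From HB Require Import structures.
From mathcomp Require Import all_boot all_order all_algebra.
From mathcomp Require Import all_classical all_reals all_analysis.
Set Implicit Arguments.
Unset Strict Implicit.
Unset Printing Implicit Defensive.
Import Order.TTheory GRing.Theory Num.Theory.
Import numFieldNormedType.Exports.
Local Open Scope classical_set_scope.
Local Open Scope ring_scope.

(* Division in \bar R is the library's: 0^-1 = +oo and 0 * +oo = 0, so that
   a / 0 = +oo for a > 0 and 0 / 0 = 0. *)

Section Activation.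
Context {R : realType}.
Implicit Types (sigma : R -> R) (eps tau : R).

Definition smooth sigma := forall n x, derivable (derive1n n sigma) x 1.

Definition relu_tail sigma eps tau :=
  (forall x, x < - tau -> Num.max `|sigma x| `|derive1 sigma x| < eps) /\
  (forall x, tau < x ->
     Num.max `|sigma x / x - 1| `|derive1 sigma x - 1| < eps).

Definition relu_like sigma :=
  smooth sigma /\
  forall eps, 0 < eps -> exists2 tau, 0 < tau & relu_tail sigma eps tau.

Definition sup_norm (I : set R) (h : R -> R) : \bar R :=
  ereal_sup [set `|h x|%:E | x in I].

Definition mlp d D sigma (Wup : 'M[R]_(D, d)) (Wdown : 'M[R]_(d, D))
    (x : 'cV[R]_d) : 'cV[R]_d :=
  Wdown *m map_mx sigma (Wup *m x).

End Activation.

Section Norms.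
Context {R : realType}.

(* Meant for 1 <= p. *)
Definition lpnorm n (p : \bar R) (v : 'cV[R]_n) : R :=
  match p with
  | EFin r => (\sum_i `|v i 0| `^ r) `^ r^-1
  | +oo%E => \big[Num.max/0]_i `|v i 0|
  | -oo%E => 0
  end.

Definition opnorm m n (p q : \bar R) (A : 'M[R]_(m, n)) : \bar R :=
  ereal_sup [set (lpnorm q (A *m v))%:E | v in [set v | lpnorm p v <= 1]].

(* ||diag(u)^-1 A||_{r,oo}, also when diag(u) is singular: the vector
   diag(u)^-1 A v is formed with the division conventions above, so the value
   is +oo as soon as some row i of A with u_i = 0 is nonzero, and the zero rows
   of A do not contribute. *)
Definition invdiag_opnorm m n (r : \bar R) (u : 'cV[R]_m) (A : 'M[R]_(m, n))
    : \bar R :=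
  ereal_sup [set \big[maxe/0%E]_i (`|(A *m v) i 0|%R%:E / `|u i 0|%R%:E)%E
            | v in [set v | lpnorm r v <= 1]].

Lemma invdiag_opnormE m n (r : \bar R) (u : 'cV[R]_m) (A : 'M[R]_(m, n)) :
  (forall i, u i 0 != 0) ->
  invdiag_opnorm r u A = opnorm r +oo%E (invmx (diag_mx u^T) *m A).
Proof.
move=> u0.
have -> : invmx (diag_mx u^T) = diag_mx (\row_i (u i 0)^-1).
  have H : diag_mx (\row_i (u i 0)^-1) *m diag_mx u^T = 1%:M.
    apply/matrixP => i j; rewrite mul_diag_mx !mxE.
    by case: eqP => [->|]; rewrite ?mulr0// mulr1n mulVf.
  have uU : diag_mx u^T \in unitmx by case: (mulmx1_unit H).
  by rewrite -[LHS]mul1mx -H mulmxK.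
congr ereal_sup; apply: eq_imagel => v _ /=.
rewrite -mulmxA.
elim/big_rec2 : _ => // i x y _ ->.
rewrite mul_diag_mx !mxE EFin_max; congr maxe.
by rewrite inver normr_eq0 (negbTE (u0 i)) -EFinM normrM normfV mulrC.
Qed.

Definition subcols D d (A : 'M[R]_(d, D)) (Omega : {set 'I_D}) :
  'M[R]_(d, #|Omega|) := colsub (@enum_val _ (mem Omega)) A.

Definition subrows D d (A : 'M[R]_(D, d)) (Omega : {set 'I_D}) :
  'M[R]_(#|Omega|, d) := rowsub (@enum_val _ (mem Omega)) A.

End Norms.

Section Condition.
Context {R : realType}.

Variant metric : Type := Normwise of \bar R | Componentwise.

Definition rho n (theta : metric) (w' w : 'cV[R]_n) : \bar R :=
  match theta with
  | Normwise p => (lpnorm p (w' - w)%R)%:E / (lpnorm p w)%:E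
  | Componentwise => \big[maxe/0]_i (`|w' i 0 - w i 0|%R%:E / `|w i 0|%R%:E)
  end%E.

Definition kappa n m (tin tout : metric) (f : 'cV[R]_n -> 'cV[R]_m)
    (v : 'cV[R]_n) : \bar R :=
  lim ((ereal_sup [set (rho tout (f v') (f v) / rho tin v' v)%E
                  | v' in [set v' | (rho tin v' v <= t%:E)%E]]) @[t --> 0^'+]).

(* a * b has the form 0 * oo, to which the library gives the value 0. In the
   bounds the only harmful such product has a = sup |sigma'| over [-tau, tau]:
   take d = D = 1, unit weights, eps = 2 and sigma vanishing exactly on
   ]-oo, tau]; then at x = tau the function is 0, all condition numbers are
   +oo, and the coefficients of the bounds are 0. This requires eps >= 1: for
   eps < 1, continuity gives sigma'(tau) >= 1 - eps > 0, whence a > 0. *)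
Definition indeterminate (a b : \bar R) := (a = 0 /\ b = +oo)%E.

End Condition.

(* Main.v *)
(* Split the hidden coordinates into classes k = -, 0, + with index sets O k, on
   which |sigma'(y_i)| is at most c_k = eps, sup |sigma'|, 1 + eps. Writing
   h = x' - x, differentiability of sigma at the y_i alone gives, for every
   delta > 0 and h small, |sigma(y'_i) - sigma(y_i)| <= (c_k + delta) |(Wup h)_i|
   for i in O k. If U k and V k are the gains from the relative input error to
   |Wup(O k, :) h|_r and from |z|_r to the relative size of Wdown(:, O k) z, the
   triangle inequality bounds the quotient of relative errors by
   sum_k (c_k + delta) V_k U_k; then delta tends to 0. The four bounds are the
   four combinations of normwise and componentwise gains. *)

Require Import Defs.
From HB Require Import structures.
From mathcomp Require Import all_boot all_order all_algebra.
From mathcomp Require Import ring lra.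
From mathcomp Require Import all_classical all_reals all_analysis.
Import Order.TTheory GRing.Theory Num.Theory.
Import numFieldNormedType.Exports.
Local Open Scope classical_set_scope.
Local Open Scope ring_scope.

Section MlpConditioning.
Set Implicit Arguments.
Unset Strict Implicit.
Context {R : realType}.
Implicit Types (p q r : \bar R) (a s : R) (theta tin tout : @metric R).

(** * Vector norms: monotonicity, homogeneity and Minkowski's inequality *)

Lemma le1e_cases p : (1 <= p)%E -> p = +oo%E \/ exists2 s, 1 <= s & p = s%:E.
Proof.
by case: p => [s||] //; [rewrite lee_fin => s1; right; exists s | left].
Qed.

Lemma lpnorm_ge0 n p (v : 'cV[R]_n) : 0 <= lpnorm p v.
Proof.
case: p => [s||] //=; first exact: powR_ge0.
by elim/big_ind : _ => // x y x0 y0; rewrite le_max x0.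
Qed.

Lemma powR_sum_lpnorm n s (v : 'cV[R]_n) : s != 0 ->
  lpnorm s%:E v `^ s = \sum_i `|v i 0| `^ s.
Proof.
by move=> s0; rewrite /= -powRrM mulVf// powRr1// sumr_ge0.
Qed.

Lemma lpnorm_coord n p (v : 'cV[R]_n) i : (1 <= p)%E -> `|v i 0| <= lpnorm p v.
Proof.
move=> /le1e_cases[->|[s s1 ->]]; first exact: (le_bigmax _ (fun i => `|v i 0|)).
have s0 : s != 0 by rewrite gt_eqF// (lt_le_trans ltr01).
have -> : `|v i 0| = (`|v i 0| `^ s) `^ s^-1 by rewrite -powRrM mulfV// powRr1.
rewrite ge0_ler_powR ?invr_ge0 ?nnegrE ?powR_ge0 ?sumr_ge0 ?(le_trans ler01 s1)//.
by rewrite (bigD1 i)//= lerDl sumr_ge0.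
Qed.

Lemma lpnorm_eq0 n p (v : 'cV[R]_n) : (1 <= p)%E -> lpnorm p v = 0 -> v = 0.
Proof.
move=> p1 v0; apply/colP => i; rewrite mxE; apply/eqP.
by rewrite -normr_le0 -v0 lpnorm_coord.
Qed.

Lemma lpnorm0 n p : (1 <= p)%E -> lpnorm p (0 : 'cV[R]_n) = 0.
Proof.
move=> /le1e_cases[->|[s s1 ->]] /=.
  by rewrite big1_idem /= ?maxxx// => i _; rewrite mxE normr0.
have s0 : s != 0 by rewrite gt_eqF// (lt_le_trans ltr01).
by rewrite big1 ?powR0 ?invr_eq0// => i _; rewrite mxE normr0 powR0.
Qed.

Lemma lpnorm_mono n p (u v : 'cV[R]_n) : (1 <= p)%E ->
  (forall i, `|u i 0| <= `|v i 0|) -> lpnorm p u <= lpnorm p v.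
Proof.
move=> /le1e_cases[->|[s s1 ->]] uv /=; first exact: le_bigmax2.
have s0 : 0 <= s by rewrite (le_trans ler01).
rewrite ge0_ler_powR ?invr_ge0 ?nnegrE ?sumr_ge0//.
by apply: ler_sum => i _; rewrite ge0_ler_powR ?nnegrE.
Qed.

Lemma lpnormZ n p a (v : 'cV[R]_n) : (1 <= p)%E ->
  lpnorm p (a *: v) = `|a| * lpnorm p v.
Proof.
move=> /le1e_cases[->|[s s1 ->]] /=.
  elim/big_rec2 : _ => [|i x y _ ->]; first by rewrite mulr0.
  by rewrite mxE normrM maxr_pMr.
have s0 : s != 0 by rewrite gt_eqF// (lt_le_trans ltr01).
under eq_bigr do rewrite mxE normrM powRM//.
rewrite -mulr_sumr powRM ?powR_ge0 ?sumr_ge0//.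
by rewrite -powRrM mulfV// powRr1.
Qed.

Lemma powR_conv s t (x y : R) : 1 <= s -> 0 <= t -> t <= 1 -> 0 <= x -> 0 <= y ->
  (t * x + (1 - t) * y) `^ s <= t * x `^ s + (1 - t) * y `^ s.
Proof.
move=> s1 t0 t1 x0 y0.
have := @convex_powR R s s1 (Itv01 t0 t1) x y.
by rewrite !convRE/=; apply; rewrite inE/= in_itv/= andbT.
Qed.

(* With t = a / (a + b), the vector (u + v) / (a + b) is dominated by the
   t-convex combination of the vectors u / a and v / b, of s-norm 1. *)
Lemma powR_sum_addr n s (u v : 'cV[R]_n) a b : 1 <= s -> 0 < a -> 0 < b ->
  \sum_i `|u i 0| `^ s = a `^ s -> \sum_i `|v i 0| `^ s = b `^ s ->
  \sum_i `|(u + v) i 0| `^ s <= (a + b) `^ s.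
Proof.
move=> s1 a0 b0 ua vb; have ab0 : 0 < a + b by rewrite addr_gt0.
have s_ge0 : 0 <= s := le_trans ler01 s1.
pose t := a / (a + b).
have t0 : 0 <= t by rewrite divr_ge0// ltW.
have t1 : t <= 1 by rewrite ler_pdivrMr// mul1r lerDl ltW.
have le_term i : `|(u + v) i 0| `^ s <=
    (a + b) `^ s * (t * (`|u i 0| / a) `^ s + (1 - t) * (`|v i 0| / b) `^ s).
  apply: (@le_trans _ _ ((a + b) `^ s *
      (t * (`|u i 0| / a) + (1 - t) * (`|v i 0| / b)) `^ s)); last first.
    by rewrite ler_wpM2l ?powR_ge0// powR_conv// divr_ge0// ltW.
  (* The weights cancel the normalisations: t / a = (1 - t) / b = 1 / (a + b). *)
  have -> : t * (`|u i 0| / a) + (1 - t) * (`|v i 0| / b) =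
      (`|u i 0| + `|v i 0|) / (a + b).
    by rewrite /t; field; rewrite !lt0r_neq0.
  rewrite -powRM ?divr_ge0 ?addr_ge0 ?(ltW a0) ?(ltW b0)//.
  rewrite mulrC divfK ?gt_eqF// mxE ge0_ler_powR ?nnegrE ?addr_ge0//.
  exact: ler_normD.
have sum1 (w : 'cV[R]_n) c : 0 < c -> \sum_i `|w i 0| `^ s = c `^ s ->
    \sum_i (`|w i 0| / c) `^ s = 1.
  move=> c0 wc; under eq_bigr do rewrite powRM// ?invr_ge0 ?(ltW c0)//.
  by rewrite -mulr_suml wc -powRM ?invr_ge0 ?(ltW c0)// mulfV ?gt_eqF// powR1.
apply: (le_trans (ler_sum _ (fun i _ => le_term i))).
by rewrite -mulr_sumr big_split/= -!mulr_sumr !sum1// !mulr1 addrC subrK mulr1.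
Qed.

(** Minkowski's inequality. Vectors of norm zero vanish and are treated first, since for finite
    exponents [powR_sum_addr] divides by both norms; for [p = +oo] the bound is coordinatewise. *)
Lemma lpnormD n p (u v : 'cV[R]_n) : (1 <= p)%E ->
  lpnorm p (u + v) <= lpnorm p u + lpnorm p v.
Proof.
move=> p1; have [u0|u_neq0] := eqVneq (lpnorm p u) 0.
  by rewrite (lpnorm_eq0 p1 u0) lpnorm0// !add0r.
have [v0|v_neq0] := eqVneq (lpnorm p v) 0.
  by rewrite (lpnorm_eq0 p1 v0) lpnorm0// !addr0.
have a0 : 0 < lpnorm p u by rewrite lt_neqAle eq_sym u_neq0 lpnorm_ge0.
have b0 : 0 < lpnorm p v by rewrite lt_neqAle eq_sym v_neq0 lpnorm_ge0.
move: p1 a0 b0 {u_neq0 v_neq0} => /le1e_cases[->|[s s1 ->]] a0 b0.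
  apply/bigmax_leP; split=> [|i _]; first by rewrite addr_ge0// lpnorm_ge0.
  by rewrite mxE (le_trans (ler_normD _ _))// lerD// lpnorm_coord// leey.
have s_gt0 : 0 < s := lt_le_trans ltr01 s1.
have s_neq0 : s != 0 := lt0r_neq0 s_gt0.
have h := powR_sum_addr s1 a0 b0 (esym (powR_sum_lpnorm _ s_neq0))
  (esym (powR_sum_lpnorm _ s_neq0)).
rewrite -powR_sum_lpnorm// in h.
have powR_le x y : 0 <= x -> 0 <= y -> x `^ s <= y `^ s -> x <= y.
  move=> x0 y0; rewrite leNgt => /negP xy; rewrite leNgt; apply/negP => yx.
  by apply: xy; rewrite gt0_ltr_powR.
by apply: powR_le h; rewrite ?addr_ge0 ?lpnorm_ge0.
Qed.

Lemma lpnorm_sum n p (I : Type) (r : seq I) (w : I -> 'cV[R]_n) : (1 <= p)%E ->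
  lpnorm p (\sum_(i <- r) w i) <= \sum_(i <- r) lpnorm p (w i).
Proof.
move=> p1; elim: r => [|i r IH]; first by rewrite !big_nil lpnorm0.
by rewrite !big_cons (le_trans (lpnormD _ _ p1))// lerD2l.
Qed.

(** * Operator norms and gains of linear maps *)

Lemma opnorm_ge0 m n p q (A : 'M[R]_(m, n)) : (1 <= p)%E ->
  (0 <= opnorm p q A)%E.
Proof.
move=> p1; apply: (@le_trans _ _ (lpnorm q (A *m 0))%:E).
  by rewrite lee_fin lpnorm_ge0.
by apply: ereal_sup_ubound; exists 0 => //=; rewrite lpnorm0.
Qed.

(** On the unit ball every coordinate of v has modulus at most 1, so expanding A v along the columns
    of A bounds the supremum by the sum of the column norms. *)
Lemma opnorm_fin_num m n p q (A : 'M[R]_(m, n)) : (1 <= p)%E -> (1 <= q)%E ->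
  opnorm p q A \is a fin_num.
Proof.
move=> p1 q1; rewrite ge0_fin_numE ?opnorm_ge0//.
apply: (@le_lt_trans _ _ (\sum_j lpnorm q (col j A))%:E); last exact: ltry.
apply: ge_ereal_sup => _ [v /= v1 <-]; rewrite lee_fin.
have -> : A *m v = \sum_j v j 0 *: col j A.
  apply/colP => i; rewrite mxE summxE; apply: eq_bigr => j _.
  by rewrite !mxE mulrC.
rewrite (le_trans (lpnorm_sum _ _ q1))//; apply: ler_sum => j _.
rewrite lpnormZ// ler_piMl ?lpnorm_ge0//.
by rewrite (le_trans (lpnorm_coord _ _ p1)).
Qed.

(** Rescale z to the unit sphere. The functional [N] is abstract and extended-valued in order to
    cover both norms and relative errors with zero denominators. If z has norm 0, the right side is
    0 even for [V = +oo]; then z = 0 and [N 0 = 0] applies. *)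
Lemma gain_le m n r (N : 'cV[R]_m -> \bar R) (A : 'M[R]_(m, n)) (V : \bar R)
    (z : 'cV[R]_n) : (1 <= r)%E ->
  N 0 = 0%E -> (forall a w, 0 < a -> (N (a *: w) <= a%:E * N w)%E) ->
  (forall v, lpnorm r v <= 1 -> (N (A *m v) <= V)%E) ->
  (N (A *m z) <= V * (lpnorm r z)%:E)%E.
Proof.
move=> r1 N0 NZ NV; have [z0|z0] := eqVneq (lpnorm r z) 0.
  by rewrite z0 mule0 (lpnorm_eq0 r1 z0) mulmx0 N0.
have a0 : 0 < lpnorm r z by rewrite lt_neqAle eq_sym z0 lpnorm_ge0.
have -> : A *m z = lpnorm r z *: (A *m ((lpnorm r z)^-1 *: z)).
  by rewrite -scalemxAr scalerA mulfV// scale1r.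
rewrite (le_trans (NZ _ _ a0))// muleC lee_wpmul2r ?lee_fin ?(ltW a0)//.
by apply: NV; rewrite lpnormZ// gtr0_norm ?invr_gt0// mulVf.
Qed.

Lemma lpnorm_mulmx_le m n p q (A : 'M[R]_(m, n)) (z : 'cV[R]_n) :
  (1 <= p)%E -> (1 <= q)%E ->
  lpnorm q (A *m z) <= fine (opnorm p q A) * lpnorm p z.
Proof.
move=> p1 q1; rewrite -lee_fin EFinM fineK ?opnorm_fin_num//.
apply: (gain_le (N := fun w => (lpnorm q w)%:E)) => //.
- by rewrite lpnorm0.
- by move=> a w a0; rewrite lpnormZ// gtr0_norm.
- by move=> v v1; apply: ereal_sup_ubound; exists v.
Qed.



(** * Relative errors and their gains *)

(** This is [rho] as a function of the perturbation z around a fixed reference u; in this form it is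
    sublinear in z, for both kinds of metric. *)
Definition relnorm n theta (u z : 'cV[R]_n) : \bar R :=
  match theta with
  | Normwise p => (lpnorm p z)%:E / (lpnorm p u)%:E
  | Componentwise => \big[maxe/0]_i (`|z i 0|%R%:E / `|u i 0|%R%:E)
  end%E.

Definition proper_metric theta : Prop :=
  if theta is Normwise p then (1 <= p)%E else True.

Lemma rhoE n theta (w' w : 'cV[R]_n) : rho theta w' w = relnorm theta w (w' - w).
Proof.
case: theta => //=; elim/big_rec2 : _ => // i x y _ ->.
by rewrite !mxE.
Qed.

Lemma relnorm_ge0 n theta (u z : 'cV[R]_n) : (0 <= relnorm theta u z)%E.
Proof.
case: theta => [p|] /=; first by rewrite mule_ge0 ?inve_ge0 ?lee_fin ?lpnorm_ge0.
by elim/big_ind : _ => // [x y x0 y0|i _]; rewrite ?le_max ?x0// mule_ge0 ?inve_ge0.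
Qed.

Lemma relnorm0 n theta (u : 'cV[R]_n) : proper_metric theta ->
  relnorm theta u 0 = 0%E.
Proof.
case: theta => [p|_] /=; first by move=> p1; rewrite lpnorm0// mul0e.
by rewrite big1_idem /= ?maxxx// => i _; rewrite mxE normr0 mul0e.
Qed.

Lemma relnormZ n theta (u z : 'cV[R]_n) (a : R) : proper_metric theta -> 0 < a ->
  (relnorm theta u (a *: z) <= a%:E * relnorm theta u z)%E.
Proof.
case: theta => [p|_] /=.
  by move=> p1 a0; rewrite lpnormZ// gtr0_norm// EFinM muleA.
move=> a0; apply/bigmax_leP; split=> [|i _].
  by rewrite mule_ge0 ?lee_fin ?(ltW a0)// (relnorm_ge0 Componentwise).
rewrite mxE normrM gtr0_norm// EFinM -muleA lee_wpmul2l ?lee_fin ?(ltW a0)//.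
exact: (le_bigmax _ (fun i => `|z i 0|%:E / `|u i 0|%:E)%E).
Qed.

Lemma relnormD n theta (u z w : 'cV[R]_n) : proper_metric theta ->
  (relnorm theta u (z + w) <= relnorm theta u z + relnorm theta u w)%E.
Proof.
case: theta => [p|_] /=.
  (* The common factor is +oo when u has norm 0, so distributivity rests on the signs of the
     summands. *)
  move=> p1; rewrite -ge0_muleDl ?lee_fin ?lpnorm_ge0//.
  by rewrite lee_wpmul2r ?inve_ge0 ?lee_fin ?lpnorm_ge0// lpnormD.
apply/bigmax_leP; split=> [|i _].
  by rewrite adde_ge0// (relnorm_ge0 Componentwise).
apply: (@le_trans _ _ (`|z i 0|%:E / `|u i 0|%:E + `|w i 0|%:E / `|u i 0|%:E)%E).
  by rewrite -ge0_muleDl// lee_wpmul2r ?inve_ge0// mxE lee_fin ler_normD.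
by apply: leeD; apply: (le_bigmax _ (fun i => `|_ i 0|%:E / `|u i 0|%:E)%E).
Qed.

Lemma relnorm_sum n theta (I : Type) (s : seq I) (u : 'cV[R]_n)
    (w : I -> 'cV[R]_n) : proper_metric theta ->
  (relnorm theta u (\sum_(i <- s) w i) <= \sum_(i <- s) relnorm theta u (w i))%E.
Proof.
move=> pt; elim: s => [|i s IH]; first by rewrite !big_nil relnorm0.
by rewrite !big_cons (le_trans (relnormD _ _ _ pt))// leeD2l.
Qed.

(** Provides the output gain V in the normwise case; it is +oo when u = 0 and A has nonzero norm. *)
Lemma relnorm_normwise_gain m n q r (u : 'cV[R]_m) (A : 'M[R]_(m, n)) z :
  (1 <= q)%E -> (1 <= r)%E ->
  (relnorm (Normwise q) u (A *m z) <=
   opnorm r q A / (lpnorm q u)%:E * (lpnorm r z)%:E)%E.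
Proof.
move=> q1 r1; apply: gain_le => // [|a w a0|v v1]; first exact: relnorm0.
  exact: relnormZ.
rewrite lee_wpmul2r ?inve_ge0 ?lee_fin ?lpnorm_ge0//.
by apply: ereal_sup_ubound; exists v.
Qed.

Lemma relnorm_componentwise_gain m n r (u : 'cV[R]_m) (A : 'M[R]_(m, n)) z :
  (1 <= r)%E ->
  (relnorm Componentwise u (A *m z) <= invdiag_opnorm r u A * (lpnorm r z)%:E)%E.
Proof.
move=> r1; apply: gain_le => // [|a w a0|v v1]; first exact: relnorm0.
  exact: relnormZ.
by apply: ereal_sup_ubound; exists v.
Qed.

Lemma invdiag_opnorm_ge0 m n r (u : 'cV[R]_m) (A : 'M[R]_(m, n)) :
  (1 <= r)%E -> (0 <= invdiag_opnorm r u A)%E.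
Proof.
move=> r1; apply: (@le_trans _ _ (relnorm Componentwise u (A *m 0))).
  exact: relnorm_ge0.
by apply: ereal_sup_ubound; exists 0 => //=; rewrite lpnorm0.
Qed.

(** Provides the input gain U in the normwise case. If x has norm 0, finiteness of the relative
    error forces h = 0, as any other h would have error +oo. *)
Lemma normwise_relnorm_gain m n p r (x h : 'cV[R]_n) (A : 'M[R]_(m, n)) rh :
  (1 <= p)%E -> (1 <= r)%E -> relnorm (Normwise p) x h = rh%:E ->
  lpnorm r (A *m h) <= fine (opnorm p r A) * lpnorm p x * rh.
Proof.
move=> p1 r1 /= hE; rewrite -mulrA (le_trans (lpnorm_mulmx_le _ _ p1 r1))//.
rewrite ler_wpM2l ?fine_ge0 ?opnorm_ge0//; move: hE; rewrite inver.
have [x0|x0 [<-]] := eqVneq (lpnorm p x) 0; last by rewrite mulrC divfK.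
have [->|h0] := eqVneq (lpnorm p h) 0; first by rewrite x0 mul0r.
by rewrite gt0_muley// lte_fin lt_neqAle eq_sym h0 lpnorm_ge0.
Qed.

(** A finite componentwise error makes h vanish wherever x does, so h = diag(x) u with u_i = h_i /
    x_i, and the sup norm of u is at most [rh]. *)
Lemma componentwise_relnorm_gain m n r (x h : 'cV[R]_n) (A : 'M[R]_(m, n)) rh :
  (1 <= r)%E -> relnorm Componentwise x h = rh%:E ->
  lpnorm r (A *m h) <= fine (opnorm +oo%E r (A *m diag_mx x^T)) * rh.
Proof.
move=> r1 /= hE; pose u : 'cV[R]_n := \col_i (h i 0 / x i 0).
have h_le i : (`|h i 0|%:E / `|x i 0|%:E <= rh%:E)%E.
  by rewrite -hE (le_bigmax _ (fun i => `|h i 0|%:E / `|x i 0|%:E)%E).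
have h0 i : x i 0 = 0 -> h i 0 = 0.
  move=> x0; apply/eqP; apply: contraTT isT => hi0; have := h_le i.
  by rewrite x0 normr0 inve0 gt0_muley// lte_fin normr_gt0.
have -> : A *m h = A *m diag_mx x^T *m u.
  rewrite -mulmxA; congr (_ *m _); apply/colP => i; rewrite mul_diag_mx !mxE.
  by have [x0|x0] := eqVneq (x i 0) 0; [rewrite x0 mul0r h0|rewrite mulrC divfK].
have u_le : lpnorm +oo%E u <= rh.
  apply/bigmax_leP; split=> [|i _].
    by rewrite -lee_fin -hE (relnorm_ge0 Componentwise).
  have := h_le i; rewrite mxE normrM normfV inver normr_eq0.
  case: eqVneq => [/h0 -> _|//]; rewrite normr0 mul0r.
  by rewrite -lee_fin -hE (relnorm_ge0 Componentwise).
rewrite (le_trans (lpnorm_mulmx_le (p := +oo%E) _ _ _ r1)) ?leey//.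
by rewrite ler_wpM2l ?fine_ge0 ?opnorm_ge0 ?leey.
Qed.

(** * The limit defining the condition number, and local growth of the activation *)

Lemma rho_ge0 n theta (w' w : 'cV[R]_n) : (0 <= rho theta w' w)%E.
Proof. by rewrite rhoE relnorm_ge0. Qed.

(** The supremum over errors at most t is nondecreasing in t, so its right limit at 0 exists and is
    the infimum over t > 0. A single t with bound B + e therefore suffices for each e. *)
Lemma kappa_le n m tin tout (f : 'cV[R]_n -> 'cV[R]_m) (v : 'cV[R]_n) (B : \bar R) :
  (forall e, 0 < e -> \forall t \near 0^'+, forall v', (rho tin v' v <= t%:E)%E ->
     (rho tout (f v') (f v) / rho tin v' v <= B + e%:E)%E) ->
  (kappa tin tout f v <= B)%E.
Proof.
move=> fB; rewrite /kappa.
set g := (fun t : R => ereal_sup _).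
have g_mono : {in Interval (BRight (0 : R)) +oo%O &, nondecreasing g}.
  move=> s t _ _ st; apply: le_ereal_sup => _ [v' /= v's <-].
  by exists v' => //=; rewrite (le_trans v's)// lee_fin.
rewrite (cvg_lim _ (nondecreasing_at_right_cvge _ _ g_mono))//.
apply/lee_addgt0Pr => e e0.
have [t [tB t0]] := filter_ex (filterI (fB e e0) (nbhs_right_gt (0 : R))).
apply: (@le_trans _ _ (g t)).
  by apply: ereal_inf_lbound; exists t => //=; rewrite in_itv/= t0.
by apply: ge_ereal_sup => _ [v' /= v't <-]; exact: tB.
Qed.

(** The difference quotient at y is within [delta] of the derivative for small h. The radius has the
    form M t because a relative input error of at most t moves a hidden coordinate by at most a gain
    times t. *)
Lemma derivable_local_lipschitz (f : R -> R) (y c delta M : R) :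
  derivable f y 1 -> `|derive1 f y| <= c -> 0 < delta -> 0 <= M ->
  \forall t \near 0^'+, forall h, `|h| <= M * t ->
    `|f (y + h) - f y| <= (c + delta) * `|h|.
Proof.
move=> df fc d0 M0.
have : h^-1 *: (f (h *: 1 + y) - f y) @[h --> 0^'] --> derive1 f y.
  by rewrite derive1E; exact: df.
move=> /cvgrPdist_le /(_ _ d0) /nbhs_ballP[e /= e0 He].
(* Using M + 1 instead of M keeps the divisor positive when M = 0. *)
have M1 : 0 < M + 1 by rewrite ltr_wpDl.
near=> t.
have te : t < e / (M + 1) by near: t; apply: nbhs_right_lt; rewrite divr_gt0.
have t0 : 0 < t by near: t; exact: nbhs_right_gt.
move=> h ht; have [->|h0] := eqVneq h 0; first by rewrite addr0 subrr normr0 mulr0.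
have he : `|h| < e.
  rewrite (le_lt_trans ht)//; apply: (@le_lt_trans _ _ ((M + 1) * t)).
    by rewrite ler_wpM2r ?lerDl// ltW.
  by rewrite mulrC -ltr_pdivlMr.
have := He h; rewrite /ball/= sub0r normrN => /(_ he h0) Hh.
rewrite -ler_pdivrMr ?normr_gt0// -normfV -normrM.
have -> : (f (y + h) - f y) / h = derive1 f y -
    (derive1 f y - h^-1 *: (f (h *: 1 + y) - f y)).
  by rewrite subKr mulrC -[h%:A]/(h * 1) mulr1 (addrC h).
by rewrite (le_trans (ler_normB _ _))// lerD.
Unshelve. all: by end_near. Qed.

(** * The general bound for a partition of the hidden coordinates *)

Lemma mulmx_subcols_subrows m D n (T : finType) (cl : 'I_D -> T)
    (A : 'M[R]_(m, D)) (B : 'M[R]_(D, n)) :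
  A *m B = \sum_k subcols A [set i | cl i == k]%SET *m
                  subrows B [set i | cl i == k]%SET.
Proof.
apply/matrixP => i j; rewrite mxE summxE (partition_big cl xpredT)//=.
apply: eq_bigr => k _; rewrite mxE.
under [RHS]eq_bigr do rewrite !mxE.
rewrite -(big_enum_val (fun l => A i l * B l j))/=.
by apply: eq_bigl => l; rewrite inE.
Qed.

(* The conditions c k = 0 -> V k * U k != +oo cannot be dropped: the argument
   bounds the condition number by the sum of (c k + delta) V k U k for every
   delta > 0. *)
Lemma kappa_mlp_le d D (T : finType) (cl : 'I_D -> T) (c U : T -> R)
    (V : T -> \bar R) (tin tout : @metric R) (r : \bar R) (sigma : R -> R)
    (Wup : 'M[R]_(D, d)) (Wdown : 'M[R]_(d, D)) (x : 'cV[R]_d) :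
  let F := mlp sigma Wup Wdown in
  let O k := [set i | cl i == k]%SET in
  (1 <= r)%E -> proper_metric tout ->
  (forall z, derivable sigma z 1) ->
  (forall i, `|derive1 sigma ((Wup *m x) i 0)| <= c (cl i)) ->
  (forall k, 0 <= c k) -> (forall k, 0 <= U k) -> (forall k, 0 <= V k)%E ->
  (forall k h rh, relnorm tin x h = rh%:E ->
     lpnorm r (subrows Wup (O k) *m h) <= U k * rh) ->
  (forall k z, relnorm tout (F x) (subcols Wdown (O k) *m z) <=
     V k * (lpnorm r z)%:E)%E ->
  (forall k, c k = 0 -> (V k * (U k)%:E != +oo)%E) ->
  (kappa tin tout F x <= \sum_k (c k)%:E * (V k * (U k)%:E))%E.
Proof.
move=> F O r1 tout1 dsigma sigma_le c0 U0 V0 Uin Vout cVU.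
have VU0 k : (0 <= V k * (U k)%:E)%E by rewrite mule_ge0 ?lee_fin.
(* If some product of gains is infinite, [cVU] makes its coefficient positive, so the right side is
   +oo. Otherwise all products are real numbers [g k]. *)
have [[k VUk]|VUfin] := pselect (exists k, V k * (U k)%:E = +oo)%E.
  apply: (@le_trans _ _ +oo%E); first exact: leey.
  rewrite (bigD1 k)//= VUk gt0_muley ?addye ?leey//.
    rewrite gt_eqF// (lt_le_trans (ltNyr 0))// sume_ge0// => l _.
    by rewrite mule_ge0 ?lee_fin.
  rewrite lte_fin lt_neqAle c0 andbT eq_sym; apply/eqP => /cVU.
  by rewrite VUk eqxx.
have VUfine k : (V k * (U k)%:E)%E = (fine (V k * (U k)%:E))%:E.
  rewrite fineK// ge0_fin_numE// ltey; apply/eqP => VUk.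
  by apply: VUfin; exists k.
pose g k := fine (V k * (U k)%:E)%E.
have g0 k : 0 <= g k by rewrite fine_ge0.
(* Chosen so that delta times the sum of the [g k] is at most e; the added 1 keeps the denominator
   positive when all [g k] vanish. *)
apply: kappa_le => e e0; pose delta := e / (\sum_k g k + 1).
have S0 : 0 < \sum_k g k + 1 by rewrite ltr_wpDl// sumr_ge0.
have delta0 : 0 < delta by rewrite divr_gt0.
pose y := Wup *m x.
(* There are finitely many hidden coordinates, so one t serves all of them. *)
have : \forall t \near 0^'+, forall i h, `|h| <= U (cl i) * t ->
    `|sigma (y i 0 + h) - sigma (y i 0)| <= (c (cl i) + delta) * `|h|.
  by apply: filter_forall => i; exact: derivable_local_lipschitz.
apply: filterS => t Ht x' x't.
have := rho_ge0 tin x' x; move: x't; rewrite !rhoE.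
case hE : (relnorm tin x (x' - x)) => [rh||]//; rewrite !lee_fin => rht rh0.
pose h := x' - x; pose w := Wup *m h.
pose z := map_mx sigma (Wup *m x') - map_mx sigma y.
have zE i : z i 0 = sigma (y i 0 + w i 0) - sigma (y i 0).
  rewrite !mxE; congr (sigma _ - _); rewrite -big_split/=.
  by apply: eq_bigr => j _; rewrite !mxE -mulrDr subrKC.
have wE k j : (subrows Wup (O k) *m h) j 0 = w (enum_val j) 0.
  by rewrite !mxE; apply: eq_bigr => l _; rewrite !mxE.
(* On class k, z is dominated entrywise by (c k + delta) w, and [lpnorm] is monotone in the moduli
   of the entries. *)
have z_le k : lpnorm r (subrows z (O k)) <= (c k + delta) * (U k * rh).
  apply: (@le_trans _ _ ((c k + delta) * lpnorm r (subrows Wup (O k) *m h))).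
    rewrite -[X in X * _]ger0_norm ?addr_ge0 ?(ltW delta0)// -lpnormZ//.
    apply: lpnorm_mono => // j; rewrite [subrows z _ j 0]mxE.
    rewrite [X in _ <= `|X|]mxE wE normrM [`|c k + _|]ger0_norm; last first.
      by rewrite addr_ge0 ?(ltW delta0).
    have clj : cl (enum_val j) = k by have := enum_valP j; rewrite inE => /eqP.
    have := Ht (enum_val j) (w (enum_val j) 0); rewrite zE clj; apply.
    apply: (@le_trans _ _ (U k * rh)).
      by rewrite -wE (le_trans (lpnorm_coord _ _ r1))// Uin.
    by rewrite ler_wpM2l.
  by rewrite ler_wpM2l ?addr_ge0 ?(ltW delta0)// Uin.
have out_le : (relnorm tout (F x) (F x' - F x) <=
    (\sum_k (c k + delta) * g k)%:E * rh%:E)%E.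
  have -> : F x' - F x = Wdown *m z by rewrite mulmxBr.
  rewrite (mulmx_subcols_subrows cl).
  rewrite (le_trans (relnorm_sum _ _ _ tout1))// -EFinM mulr_suml -sumEFin.
  apply: lee_sum => k _; rewrite (le_trans (Vout k _))//.
  apply: (@le_trans _ _ (V k * ((c k + delta) * (U k * rh))%:E)%E).
    by rewrite lee_wpmul2l// lee_fin z_le.
  by rewrite !EFinM -VUfine muleCA !muleA.
rewrite (@eq_bigr _ _ _ _ _ _ _ (fun k => (c k * g k)%:E)); last first.
  by move=> k _; rewrite EFinM -VUfine.
rewrite sumEFin -EFinD.
have B0 : 0 <= \sum_k c k * g k + e.
  by rewrite addr_ge0 ?(ltW e0)// sumr_ge0// => k _; rewrite mulr_ge0.
(* For zero input error the quotient multiplies by 0^-1 = +oo; [out_le] makes the numerator exactly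
   0, and the product is 0. *)
have [rh_eq0|rh_neq0] := eqVneq rh 0.
  move: out_le; rewrite rh_eq0 mule0 => out_le.
  suff -> : relnorm tout (F x) (F x' - F x) = 0%E by rewrite mul0e lee_fin.
  by apply/eqP; rewrite eq_le out_le relnorm_ge0.
rewrite inver (negbTE rh_neq0) lee_pdivrMr ?lt_neqAle ?rh0 ?andbT 1?eq_sym//.
rewrite (le_trans out_le)// lee_wpmul2r// lee_fin.
under eq_bigr do rewrite mulrDl.
rewrite big_split/= lerD2l -mulr_sumr /delta mulrAC ler_pdivrMr//.
by rewrite ler_wpM2l ?(ltW e0)// lerDl.
Qed.

(** * The three classes of a ReLU-like activation *)

Lemma sup_norm_fin_num (a b : R) (h : R -> R) : a <= b -> continuous h ->
  sup_norm `[a, b] h \is a fin_num.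
Proof.
move=> ab ch; have [c _ c_max] : exists2 c, c \in `[a, b] &
    forall t, t \in `[a, b] -> `|h t| <= `|h c|.
  apply: (EVT_max (f := fun t => `|h t|)) => //.
  apply: continuous_subspaceT => t; apply: continuous_comp; first exact: ch.
  exact: norm_continuous.
rewrite ge0_fin_numE.
  apply: (@le_lt_trans _ _ `|h c|%:E); last exact: ltry.
  by apply: ge_ereal_sup => _ [t /= tab <-]; rewrite lee_fin c_max.
apply: (@le_trans _ _ `|h a|%:E); first by rewrite lee_fin.
by apply: ereal_sup_ubound; exists a => //=; rewrite in_itv/= lexx.
Qed.

(** Traces an infinite product of gains back to its possibly infinite factor, which carries the
    hypothesis on [indeterminate]. *)
Lemma mule_fin_eqy (a b : \bar R) : a \is a fin_num -> (0 <= b)%E ->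
  (a * b = +oo)%E -> (b = +oo)%E.
Proof. by case: b => [b||]//; case: a. Qed.

(** Keeping the gains U and V as functions of the index set lets all four pairs of metrics share
    this bound. *)
Lemma kappa_relu_le d D (sigma : R -> R) (Wup : 'M[R]_(D, d))
    (Wdown : 'M[R]_(d, D)) (x : 'cV[R]_d) (eps tau : R) (r : \bar R)
    (tin tout : @metric R) (U : {set 'I_D} -> R) (V : {set 'I_D} -> \bar R) :
  let F := mlp sigma Wup Wdown in
  let y := Wup *m x in
  let Om := [set i | y i 0 < - tau]%SET in
  let O0 := [set i | `|y i 0| <= tau]%SET in
  let Op := [set i | tau < y i 0]%SET in
  let s := sup_norm `[- tau, tau] (derive1 sigma) in
  smooth sigma -> 0 < eps -> 0 < tau -> relu_tail sigma eps tau ->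
  (1 <= r)%E -> proper_metric tout ->
  (forall O, 0 <= U O) -> (forall O, 0 <= V O)%E ->
  (forall O h rh, relnorm tin x h = rh%:E ->
     lpnorm r (subrows Wup O *m h) <= U O * rh) ->
  (forall O z, relnorm tout (F x) (subcols Wdown O *m z) <=
     V O * (lpnorm r z)%:E)%E ->
  ~ indeterminate s (V O0 * (U O0)%:E)%E ->
  (kappa tin tout F x <= eps%:E * (V Om * (U Om)%:E) + s * (V O0 * (U O0)%:E)
     + (1 + eps)%:E * (V Op * (U Op)%:E))%E.
Proof.
move=> F y Om O0 Op s sm eps0 tau0 [tailm tailp] r1 tout1 U0 V0 Uin Vout VU_indet.
(* The second derivative exists, so the first is continuous and its supremum over the compact
   interval can serve as a real coefficient. *)
have s_fin : s \is a fin_num.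
  apply: sup_norm_fin_num => [|t]; first by rewrite ge0_cp// ltW.
  by apply: differentiable_continuous; apply/derivable1_diffP; exact: (sm 1).
have le_s t : `|t| <= tau -> `|derive1 sigma t| <= fine s.
  move=> tt; rewrite -lee_fin fineK//; apply: ereal_sup_ubound.
  by exists t => //=; rewrite in_itv/= -ler_norml.
have s0 : 0 <= fine s by rewrite (le_trans _ (le_s 0 _))// normr0 ltW.
(* [None] is the middle class; [Some b] is a tail, with b true for the positive one. *)
pose cl i := if `|y i 0| <= tau then None else Some (tau < y i 0).
pose c k := if k is Some b then if b then 1 + eps else eps else fine s.
have OmE : [set i | cl i == Some false]%SET = Om.
  apply/setP => i; rewrite !inE /cl.
  have [ytau|] := leP `|y i 0| tau.
    by move: ytau; rewrite ler_norml leNgt => /andP[/negbTE-> _].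
  rewrite ltNge ler_norml negb_and -!ltNge.
  case: (ltP tau (y i 0)) => yi /=; last by rewrite orbF => ->.
  by move=> _; apply/esym/negbTE; rewrite -leNgt; lra.
have O0E : [set i | cl i == None]%SET = O0.
  by apply/setP => i; rewrite !inE /cl; case: ifP.
have OpE : [set i | cl i == Some true]%SET = Op.
  apply/setP => i; rewrite !inE /cl; have [ytau|_] := leP `|y i 0| tau.
    by rewrite ltNge (le_trans (ler_norm _) ytau).
  by case: ltP.
have c_gt0 b : 0 < c (Some b) by case: b => //=; rewrite addr_gt0.
have c0 k : 0 <= c k by case: k => [b|//]; exact: ltW.
have sigma_le i : `|derive1 sigma (y i 0)| <= c (cl i).
  rewrite /cl; case: ifPn => [/le_s//|]; rewrite ler_norml negb_and -!ltNge.
  case: (ltP tau (y i 0)) => [yi _|_ /orP[yi|//]] /=.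
    have := tailp _ yi; rewrite gt_max => /andP[_ s'].
    rewrite -[derive1 _ _](subrK 1) (le_trans (ler_normD _ _))// normr1 addrC.
    by rewrite lerD2l ltW.
  by have := tailm _ yi; rewrite gt_max => /andP[_ /ltW].
(* The tail coefficients eps and 1 + eps are positive, so only the middle class can have coefficient
   0. *)
have cVU k : c k = 0 ->
    (V [set i | cl i == k]%SET * (U [set i | cl i == k]%SET)%:E != +oo)%E.
  case: k => [b cb|/= s_eq0]; first by have := c_gt0 b; rewrite cb ltxx.
  rewrite O0E; apply/eqP => VUoo; apply: VU_indet; split=> //.
  by rewrite -(fineK s_fin) s_eq0.
have := kappa_mlp_le (cl := cl) (c := c) r1 tout1 (fun z => sm 0 z) sigma_le c0
  (fun k => U0 _) (fun k => V0 _) (fun k => Uin _) (fun k => Vout _) cVU.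
rewrite (bigD1 (Some false))//= (bigD1 None)//= (bigD1 (Some true))//=.
rewrite big_pred0 => [|[[]|]//]; rewrite adde0 addeA OmE O0E OpE.
by rewrite fineK.
Qed.

End MlpConditioning.

(** * The four condition number bounds *)

Theorem theorem4p1 (R : realType) (d D : nat) (sigma : R -> R)
    (Wup : 'M[R]_(D, d)) (Wdown : 'M[R]_(d, D)) (x : 'cV[R]_d)
    (eps tau : R) (p q r : \bar R)
    (hsigma : relu_like sigma)
    (heps : 0 < eps) (htau : 0 < tau) (hrelu : relu_tail sigma eps tau)
    (hp : (1 <= p)%E) (hq : (1 <= q)%E) (hr : (1 <= r)%E) :
  let F := mlp sigma Wup Wdown in
  let y := Wup *m x in
  let Om := [set i | y i 0 < - tau]%SET in
  let O0 := [set i | `|y i 0| <= tau]%SET in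
  let Op := [set i | tau < y i 0]%SET in
  let s := sup_norm `[- tau, tau] (derive1 sigma) in
  let nu (O : {set 'I_D}) :=
    (opnorm r q (subcols Wdown O) * opnorm p r (subrows Wup O))%E in
  let xi (O : {set 'I_D}) :=
    (opnorm r q (subcols Wdown O)
     * opnorm +oo r (subrows Wup O *m diag_mx x^T))%E in
  let eta (O : {set 'I_D}) :=
    (invdiag_opnorm r (F x) (subcols Wdown O) * opnorm p r (subrows Wup O))%E in
  let chi (O : {set 'I_D}) :=
    (invdiag_opnorm r (F x) (subcols Wdown O)
     * opnorm +oo r (subrows Wup O *m diag_mx x^T))%E in
  let nx := (lpnorm p x)%:E in
  let nF := (lpnorm q (F x))%:E in
  [/\ ~ indeterminate s (nx / nF)%E ->
      (kappa (Normwise p) (Normwise q) F x <=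
       (eps%:E * nu Om + s * nu O0 + (1 + eps)%R%:E * nu Op) * (nx / nF))%E,
      ~ indeterminate s (1 / nF)%E ->
      (kappa Componentwise (Normwise q) F x <=
       (eps%:E * xi Om + s * xi O0 + (1 + eps)%R%:E * xi Op) * (1 / nF))%E,
      ~ indeterminate s (eta O0) ->
      (kappa (Normwise p) Componentwise F x <=
       (eps%:E * eta Om + s * eta O0 + (1 + eps)%R%:E * eta Op) * nx)%E &
      ~ indeterminate s (chi O0) ->
      (kappa Componentwise Componentwise F x <=
       eps%:E * chi Om + s * chi O0 + (1 + eps)%R%:E * chi Op)%E].
Proof.
move=> F y Om O0 Op s nu xi eta chi nx nF.
have [sm _] := hsigma.
have oo1 : (1 <= +oo :> \bar R)%E by exact: leey.
have nx0 : (0 <= nx)%E by rewrite lee_fin lpnorm_ge0.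
have nFV0 : (0 <= nF^-1)%E by rewrite inve_ge0 lee_fin lpnorm_ge0.
have eps_e0 : (0 <= eps%:E)%E by rewrite lee_fin ltW.
have eps1_e0 : (0 <= (1 + eps)%:E)%E by rewrite lee_fin addr_ge0// ltW.
have s0 : (0 <= s)%E.
  apply: (@le_trans _ _ `|derive1 sigma 0|%:E); first by rewrite lee_fin.
  by apply: ereal_sup_ubound; exists 0 => //=; rewrite in_itv/= oppr_le0 ltW.
have sum3M (a : {set 'I_D} -> \bar R) (k : \bar R) : (forall O, 0 <= a O)%E ->
    ((eps%:E * a Om + s * a O0 + (1 + eps)%:E * a Op) * k =
     eps%:E * (a Om * k) + s * (a O0 * k) + (1 + eps)%:E * (a Op * k))%E.
  by move=> a0; rewrite !ge0_muleDl ?adde_ge0 ?mule_ge0// !muleA.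
(* Each product is regrouped as output gain times input gain: the norm of x joins the factor from
   [Wup], the inverse norm of F(x) the factor from [Wdown]. *)
have nuE O : (nu O * (nx / nF) = opnorm r q (subcols Wdown O) / nF *
    (fine (opnorm p r (subrows Wup O)) * lpnorm p x)%:E)%E.
  rewrite EFinM fineK ?opnorm_fin_num// /nu -!muleA; congr (_ * _)%E.
  by rewrite [in RHS]muleC -!muleA.
have xiE O : (xi O * (1 / nF) = opnorm r q (subcols Wdown O) / nF *
    (fine (opnorm +oo r (subrows Wup O *m diag_mx x^T)))%:E)%E.
  by rewrite fineK ?opnorm_fin_num// /xi div1e muleAC.
have etaE O : (eta O * nx = invdiag_opnorm r (F x) (subcols Wdown O) *
    (fine (opnorm p r (subrows Wup O)) * lpnorm p x)%:E)%E.
  by rewrite EFinM fineK ?opnorm_fin_num// /eta muleA.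
have chiE O : (chi O = invdiag_opnorm r (F x) (subcols Wdown O) *
    (fine (opnorm +oo r (subrows Wup O *m diag_mx x^T)))%:E)%E.
  by rewrite fineK ?opnorm_fin_num.
have nu_fin O : nu O \is a fin_num by rewrite fin_numM ?opnorm_fin_num.
have xi_fin O : xi O \is a fin_num by rewrite fin_numM ?opnorm_fin_num.
split=> indet.
- rewrite sum3M ?nuE => [|O]; last by rewrite mule_ge0 ?opnorm_ge0.
  apply: (kappa_relu_le (tout := Normwise q)
    (U := fun O => fine (opnorm p r (subrows Wup O)) * lpnorm p x)
    (V := fun O => (opnorm r q (subcols Wdown O) / nF)%E)
    sm heps htau hrelu hr hq) => [A|A|A h rh|A z|].
  + by rewrite mulr_ge0 ?fine_ge0 ?opnorm_ge0 ?lpnorm_ge0.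
  + by rewrite mule_ge0 ?opnorm_ge0.
  + exact: normwise_relnorm_gain.
  + exact: relnorm_normwise_gain.
  (* As [nu O0] is finite, an infinite product forces nx / nF = +oo. *)
  + rewrite -nuE; case=> s_eq0 nuoo; apply: indet; split=> //.
    by apply: mule_fin_eqy (nu_fin O0) _ nuoo; rewrite mule_ge0.
- rewrite sum3M ?xiE => [|O]; last by rewrite mule_ge0 ?opnorm_ge0.
  apply: (kappa_relu_le (tout := Normwise q)
    (U := fun O => fine (opnorm +oo r (subrows Wup O *m diag_mx x^T)))
    (V := fun O => (opnorm r q (subcols Wdown O) / nF)%E)
    sm heps htau hrelu hr hq) => [A|A|A h rh|A z|].
  + by rewrite fine_ge0 ?opnorm_ge0.
  + by rewrite mule_ge0 ?opnorm_ge0.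
  + exact: componentwise_relnorm_gain.
  + exact: relnorm_normwise_gain.
  + rewrite -xiE; case=> s_eq0 xioo; apply: indet; split=> //.
    by apply: mule_fin_eqy (xi_fin O0) _ xioo; rewrite mule_ge0.
- rewrite sum3M ?etaE => [|O]; last first.
    by rewrite mule_ge0 ?invdiag_opnorm_ge0 ?opnorm_ge0.
  apply: (kappa_relu_le (tout := Componentwise)
    (U := fun O => fine (opnorm p r (subrows Wup O)) * lpnorm p x)
    (V := fun O => invdiag_opnorm r (F x) (subcols Wdown O))
    sm heps htau hrelu hr I) => [A|A|A h rh|A z|].
  + by rewrite mulr_ge0 ?fine_ge0 ?opnorm_ge0 ?lpnorm_ge0.
  + exact: invdiag_opnorm_ge0.
  + exact: normwise_relnorm_gain.
  + exact: relnorm_componentwise_gain.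
  (* Here [nx] is the finite factor, so it is [eta O0] that must be infinite. *)
  + rewrite -etaE muleC; case=> s_eq0 etaoo; apply: indet; split=> //.
    apply: mule_fin_eqy etaoo => //.
    by rewrite mule_ge0 ?invdiag_opnorm_ge0 ?opnorm_ge0.
- rewrite !chiE.
  apply: (kappa_relu_le (tout := Componentwise)
    (U := fun O => fine (opnorm +oo r (subrows Wup O *m diag_mx x^T)))
    (V := fun O => invdiag_opnorm r (F x) (subcols Wdown O))
    sm heps htau hrelu hr I) => [A|A|A h rh|A z|].
  + by rewrite fine_ge0 ?opnorm_ge0.
  + exact: invdiag_opnorm_ge0.
  + exact: componentwise_relnorm_gain.
  + exact: relnorm_componentwise_gain.
  + by rewrite -chiE.
Qed.
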